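(* Let $(X,d_X)$ and $(Y,d_Y)$ be metric spaces, $\alpha\in(0,1)$, $K>0$, and $w$ a weight on $X$. Assume that $M>0$ is a constant such that for all $x,y\in X$ there exists $\gamma\in\Gamma(x,y)$ with $$\int_\gamma w^{\alpha-1}\le M\,d_X(x,y)^\alpha.$$ Then $$\mathrm{RO}^K_w(X,Y)\cap\Lambda^\alpha(X,Y)=\mathrm{RO}^K_w(X,Y)\cap\mathrm{B}_{w^{\alpha-1}}(X,Y).$$ Moreover, a regularly oscillating mapping $f\in\mathrm{RO}^K_w(X,Y)$ satisfies $$D^\ast f(z)\le C_f\,w(z)^{\alpha-1},\quad z\in X,$$ for some constant $C_f$ if and only if it satisfies $$d_Y(f(x),f(y))\le C'_f\,d_X(x,y)^\alpha,\quad x,y\in X,$$ for some constant $C'_f$. If the first inequality holds with constant $C_f$, then the second holds with some $C'_f\le M C_f$. If the second inequality holds with constant $C'_f$, then the first one holds with some $C_f\le\frac{2K}{\alpha}C'_f$.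
   Context: A weight on a metric space is an everywhere positive and continuous real function on it. $B_X(x,r)$ denotes the open ball in $X$. For $f:X\to Y$ between metric spaces put $D^\ast f(x)=\limsup_{y\to x}\frac{d_Y(f(x),f(y))}{d_X(x,y)}$ for $x\in X$, with $D^\ast f(x)=0$ if $x$ is isolated. $D^\ast(X,Y)$ is the class of $f:X\to Y$ with $D^\ast f(x)<\infty$ for every $x\in X$. For a weight $w$ on $X$ and a constant $K$, $\mathrm{RO}^K_w(X,Y)$ (regularly oscillating mappings with constant $K$) is the class of $f\in D^\ast(X,Y)$ that are bounded on every open ball $B_X(x,r)$, $x\in X$, $0<r<w(x)$, and satisfy $$D^\ast f(x)\le\frac{K}{r}\sup_{y\in B_X(x,r)}d_Y(f(x),f(y)),\quad x\in X,\ 0<r<w(x).$$ For a weight $v$ on $X$, $\mathrm{B}_v(X,Y)$ is the class of $f\in D^\ast(X,Y)$ for which there is a constant $C_f$ with $D^\ast f(z)\le C_f v(z)$ for all $z\in X$. $\Lambda^\alpha(X,Y)$ is the class of $f:X\to Y$ for which there is a constant $C_f$ with $d_Y(f(x),f(y))\le C_f\,d_X(x,y)^\alpha$ for all $x,y\in X$. A curve in $X$ is a continuous map $\gamma:[a,b]\to X$; its length is $\ell(\gamma)=\sup\sum_{i=1}^n d_X(\gamma(t_{i-1}),\gamma(t_i))$ over all partitions $a=t_0<\dots<t_n=b$, and it is rectifiable if $\ell(\gamma)<\infty$. $\Gamma(x,y)$ is the family of rectifiable curves in $X$ with endpoints $x$ and $y$. For a continuous function $g$ on $X$ and a rectifiable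 curve $\gamma$, $\int_\gamma g$ is the number such that for every $\varepsilon>0$ there is $\delta>0$ with $\left|\int_\gamma g-\sum_{i=1}^n g(\gamma(s_i))\,\ell(\gamma|_{[t_{i-1},t_i]})\right|<\varepsilon$ for every partition $t_0,\dots,t_n$ of $[a,b]$ with $\max_i|t_i-t_{i-1}|<\delta$ and all $s_i\in[t_{i-1},t_i]$ (integral with respect to arc length). *)

(* Defs.v *)
From HB Require Import structures.
From mathcomp Require Import all_boot all_order all_algebra.
From mathcomp Require Import all_classical all_reals all_analysis.
Import Order.TTheory GRing.Theory Num.Theory.
Import numFieldNormedType.Exports.

Set Implicit Arguments.
Unset Strict Implicit.
Unset Printing Implicit Defensive.

Local Open Scope classical_set_scope.
Local Open Scope ring_scope.

Definition weight (R : realType) (X : metricType R) (w : X -> R) : Prop :=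
  continuous w /\ forall x, 0 < w x.

(* At an isolated point the punctured neighborhood filter is improper and
   limf_esup returns -oo, whence the case distinction. *)
Definition Dstar (R : realType) (X Y : metricType R) (f : X -> Y) (x : X)
    : \bar R :=
  if `[< isolated [set: X] x >] then 0%E
  else limf_esup (fun y => (mdist (f x) (f y) / mdist x y)%:E) x^'.

Definition Dstar_class (R : realType) (X Y : metricType R) : set (X -> Y) :=
  [set f | forall x, (Dstar f x < +oo)%E].

Definition bounded_on (R : realType) (X Y : metricType R) (f : X -> Y)
    (A : set X) : Prop :=
  exists C : R, forall y z, A y -> A z -> mdist (f y) (f z) <= C.

Definition RO (R : realType) (X Y : metricType R) (K : R) (w : X -> R)
    : set (X -> Y) :=
  [set f | [/\ Dstar_class f,
    forall x r, 0 < r < w x -> bounded_on f (ball x r) &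
    forall x r, 0 < r < w x ->
      (Dstar f x <=
       (K / r)%:E * ereal_sup [set (mdist (f x) (f y))%:E | y in ball x r])%E]].

Definition Dstar_bound (R : realType) (X Y : metricType R) (v : X -> R)
    (f : X -> Y) (C : R) : Prop :=
  forall z, (Dstar f z <= (C * v z)%:E)%E.

Definition Bclass (R : realType) (X Y : metricType R) (v : X -> R)
    : set (X -> Y) :=
  [set f | Dstar_class f /\ exists C, Dstar_bound v f C].

Definition holder_bound (R : realType) (X Y : metricType R) (alpha : R)
    (f : X -> Y) (C : R) : Prop :=
  forall x y, mdist (f x) (f y) <= C * mdist x y `^ alpha.

Definition Lambda (R : realType) (X Y : metricType R) (alpha : R)
    : set (X -> Y) :=
  [set f | exists C, holder_bound alpha f C].

(* A curve [a, b] -> X is a map R -> X of which only the values on [a, b]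
   matter; the degenerate case a = b is allowed.  A partition
   a = t_0 < ... < t_n = b is given by s = [:: t_1; ...; t_n], so that
   t_i = nth b (a :: s) i. *)
Definition curve_length (R : realType) (X : metricType R) (a b : R)
    (gamma : R -> X) : \bar R :=
  ereal_sup
    [set (\sum_(0 <= i < size s)
            mdist (gamma (nth b (a :: s) i)) (gamma (nth b (a :: s) i.+1)))%:E
    | s in itv_partition a b].

Definition rectifiable_curve (R : realType) (X : metricType R) (a b : R)
    (gamma : R -> X) : Prop :=
  [/\ a <= b, {within `[a, b], continuous gamma} &
      (curve_length a b gamma < +oo)%E].

(* "The integral of g along gamma|[a, b] exists and equals I", for a
   rectifiable gamma; fine is then harmless since all lengths are finite. *)
Definition is_curve_integral (R : realType) (X : metricType R) (g : X -> R)
    (a b : R) (gamma : R -> X) (I : R) : Prop :=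
  forall eps : R, 0 < eps -> exists2 delta : R, 0 < delta &
    forall (s : seq R) (xi : nat -> R),
      itv_partition a b s ->
      (forall i, (i < size s)%N ->
         `|nth b (a :: s) i.+1 - nth b (a :: s) i| < delta) ->
      (forall i, (i < size s)%N ->
         nth b (a :: s) i <= xi i <= nth b (a :: s) i.+1) ->
      `|I - \sum_(0 <= i < size s) g (gamma (xi i)) *
          fine (curve_length (nth b (a :: s) i) (nth b (a :: s) i.+1) gamma)|
      < eps.

(* Main.v *)
Require Import Defs.
From HB Require Import structures.
From mathcomp Require Import all_boot all_order all_algebra.
From mathcomp Require Import all_classical all_reals all_analysis.
From mathcomp Require Import ring.
Import Order.TTheory GRing.Theory Num.Theory.
Import numFieldNormedType.Exports.

Set Implicit Arguments.
Unset Strict Implicit.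
Unset Printing Implicit Defensive.

Local Open Scope classical_set_scope.
Local Open Scope ring_scope.

(** Both classes express the same growth of f, infinitesimally and globally.

    From the global bound to D*: if f is alpha-Holder with constant C', then
    on the ball of centre z and radius r the supremum of d(f z, f y) is at most
    C' r^alpha, so regular oscillation gives D* f z <= K C' r^(alpha - 1).
    The radius r = w z / 2 already suffices: the lost factor 2^(1 - alpha) is
    at most 2 <= 2 / alpha ([holder_Dstar_bound]).

    From D* to the global bound: put v = w^(alpha - 1).  It is enough to
    show d(f x, f y) <= C I whenever I is the integral of v along a rectifiable
    curve gamma from x to y and D* f <= C v ([mdist_le_curve_integral]).
    Since v > 0, the bound D* f < (C + eps) v is strict everywhere, so near each
    parameter t the increments of f along gamma issued from gamma t are at
    most (C + eps) v(gamma t) times those of gamma.  How near depends on t with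
    no uniformity; Cousin's lemma ([cousin]) still provides one tagged partition
    all of whose intervals are short enough for their own tags.  Adding up the
    increments of f bounds d(f x, f y) by C + eps times exactly a Riemann
    sum of v with respect to arc length, and that sum is within eps of I.
    Because the slack eps is put on the factor C rather than added to C v, the
    error is proportional to the Riemann sum itself. *)

(** * The upper derivative *)

Section oscillation.
Context {R : realType} {X Y : metricType R}.
Implicit Types (f : X -> Y) (v : X -> R).

Lemma Dstar_ge0 f x : (0 <= Dstar f x)%E.
Proof.
rewrite /Dstar; case: asboolP => // nisox; apply: (@limf_esup_ge0 X).
  move=> x'0; apply: nisox; split; first by rewrite inE.
  exists [set x] => /=; last by rewrite setIT.
  move: x'0; rewrite /dnbhs /within /=; apply: filterS => y /= yx0 /=.
  by case: (eqVneq y x) => // /yx0.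
by move=> y; rewrite lee_fin divr_ge0// mdist_ge0.
Qed.

Lemma Dstar_bound_ge0 v f (C : R) (x : X) :
  0 < v x -> Dstar_bound v f C -> 0 <= C.
Proof.
move=> vx0 /(_ x) /(le_trans (Dstar_ge0 f x)).
by rewrite lee_fin pmulr_lge0.
Qed.

(** Turns the limsup over punctured neighborhoods into an inequality on a full
    neighborhood: clearing the denominator makes it hold at [y = x] as well,
    which is also all that is to be checked when [x] is isolated. *)
Lemma Dstar_lt_near f x (c : R) : (Dstar f x < c%:E)%E ->
  \forall y \near x, mdist (f x) (f y) <= c * mdist x y.
Proof.
rewrite /Dstar; case: asboolP => [[_ [V nV]]|nisox].
  rewrite setIT => Vx _; apply: filterS nV; rewrite Vx => _ ->.
  by rewrite !mdistxx mulr0.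
move=> /ereal_inf_lt[_ [V x'V <-]] Vc.
move: x'V; rewrite /dnbhs /within /=; apply: filterS => y /= yV.
have [->|yx] := eqVneq y x; first by rewrite !mdistxx mulr0.
rewrite -ler_pdivrMr ?mdist_gt0 1?eq_sym// -lee_fin.
by apply: le_trans (ltW Vc); apply: ereal_sup_ubound; exists y => //; exact: yV.
Qed.

End oscillation.

(** * Tagged partitions *)

Section partitions.
Context {R : realType}.

(** Cousin's lemma.  The gauge (the radius [e] at [t]) is kept inside the
    hypothesis, so that an arbitrary property of tagged intervals which holds
    for all small enough intervals around each tag can be transported to a
    whole partition.  The proof considers the infimum of the points [c] such
    that [c, b] has such a partition: an interval tagged at this infimum can be
    prepended, so it is not above [a]. *)
Lemma cousin (a b : R) (P : R -> R -> R -> Prop) : a <= b ->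
  (forall t, a <= t <= b -> exists2 e, 0 < e & forall u v,
     a <= u -> u <= t <= v -> v <= b -> u < v -> t - e < u -> v < t + e ->
     P u t v) ->
  exists s xi, [/\ itv_partition a b s,
    forall i, (i < size s)%N -> nth b (a :: s) i <= xi i <= nth b (a :: s) i.+1
    & forall i, (i < size s)%N ->
      P (nth b (a :: s) i) (xi i) (nth b (a :: s) i.+1)].
Proof.
move=> ab locP.
pose T c s xi := [/\ itv_partition c b s,
  forall i, (i < size s)%N -> nth b (c :: s) i <= xi i <= nth b (c :: s) i.+1 &
  forall i, (i < size s)%N -> P (nth b (c :: s) i) (xi i) (nth b (c :: s) i.+1)].
pose S := [set c | a <= c <= b /\ exists s xi, T c s xi].
have Sb : S b.
  by split; [rewrite ab lexx|exists [::], (fun=> b); split => //; split].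
have lbS : has_lbound S by exists a => c [/andP[]].
have aS : a <= inf S by apply: lb_le_inf; [exists b|move=> c [/andP[]]].
have Sb' : inf S <= b by exact: ge_inf.
have [|e e0 eP] := locP (inf S); first by rewrite aS.
have [c [/andP[ac cb] [s [xi [pcs tags Ps]]]] ce] : exists2 c, S c & c < inf S + e.
  by apply: inf_adherent => //; split; [exists b|].
have Sc : inf S <= c by apply: ge_inf => //; split; [rewrite ac|exists s, xi].
(* The left endpoint of the interval tagged at [inf S]; it lies strictly below
   [inf S], unless it is [a]. *)
pose d := Num.max a (inf S - e / 2).
have ad : a <= d by rewrite le_max lexx.
have dS : d <= inf S by rewrite ge_max aS lerBlDr lerDl ltW// divr_gt0.
have Sd : S d.
  have [dc|] := ltP d c; last first.
    move=> cd; have -> : d = c by apply/le_anti; rewrite cd (le_trans dS).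
    by split; [rewrite ac|exists s, xi].
  split; first by rewrite ad (le_trans dS).
  exists (c :: s), (fun i => if i is j.+1 then xi j else inf S); split.
  - by case: pcs => p l; split => //=; rewrite dc.
  - by case=> [_|i] /=; [rewrite dS|exact: tags].
  - case=> [_|i] /=; last exact: Ps.
    apply: eP => //; first by rewrite dS.
    by rewrite lt_max ltrD2l ltrN2 ltr_pdivrMr// ltr_pMr// ltr1n orbT.
have : inf S <= d by exact: ge_inf.
rewrite le_max => /orP[Sa|].
  have <- : d = a by apply/le_anti; rewrite ad (le_trans dS).
  by case: Sd.
by rewrite lerBrDr gerDl leNgt divr_gt0.
Qed.

Lemma polygon_inequality (Z : metricType R) (h : R -> Z) (a b : R) (s : seq R) :
  itv_partition a b s ->
  mdist (h a) (h b) <= \sum_(0 <= i < size s)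
    mdist (h (nth b (a :: s) i)) (h (nth b (a :: s) i.+1)).
Proof.
elim: s a => [|c s IHs] a.
  by move=> /itv_partition_nil ->; rewrite mdistxx big_geq.
move=> /itv_partition_cons /IHs {}IHs.
by rewrite big_nat_recl//= (le_trans (metric_triangle _ (h c) _))// lerD2l.
Qed.

(** Frees the sum from indices and from the default value of [nth], which
    changes with the endpoint; [pairmap] is compatible with concatenation. *)
Lemma sum_partitionE (F : R -> R -> R) (a d : R) (s : seq R) :
  \sum_(0 <= i < size s) F (nth d (a :: s) i) (nth d (a :: s) i.+1)
  = \sum_(x <- pairmap F a s) x.
Proof.
elim: s a => [|c s IHs] a /=; first by rewrite big_geq// big_nil.
by rewrite big_nat_recl//= big_cons -IHs.
Qed.

End partitions.

(** * Length of subarcs *)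

Section curves.
Context {R : realType} {X : metricType R}.
Implicit Types (gamma : R -> X).

(** A partition of the smaller interval is completed by the endpoints of the
    larger one, which only adds nonnegative terms. *)
Lemma curve_length_sub gamma (a b c d : R) : a <= c -> d <= b ->
  (curve_length c d gamma <= curve_length a b gamma)%E.
Proof.
move=> ac db; apply: ge_ereal_sup => _ [s pcd <-].
pose D x y := mdist (gamma x) (gamma y).
have pR : itv_partition d b (if d < b then [:: b] else [::]).
  have [/itv_partition1//|bd] := ltP d b.
  by split => //=; rewrite eq_le db bd.
have pL : itv_partition a c (if a < c then [:: c] else [::]).
  have [/itv_partition1//|ca] := ltP a c.
  by split => //=; rewrite eq_le ca ac.
have p := itv_partition_cat (itv_partition_cat pL pcd) pR.
apply: le_trans (ereal_sup_ubound _); last by eexists; [exact: p|reflexivity].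
rewrite lee_fin (sum_partitionE D) (sum_partitionE D) !pairmap_cat !big_cat/=.
have [_ /eqP ->] := pL.
have D0 x t : 0 <= \sum_(z <- pairmap D x t) z.
  elim: t x => [|y t IHt] x; first by rewrite big_nil.
  by rewrite big_cons addr_ge0// mdist_ge0.
by rewrite -addrA addrCA lerDl addr_ge0.
Qed.

(** The tag [t] may be an endpoint, in which case it cannot be inserted in a
    strictly increasing partition. *)
Lemma mdist_le_curve_length gamma (u t v : R) : u < v -> u <= t <= v ->
  (curve_length u v gamma < +oo)%E ->
  mdist (gamma u) (gamma t) + mdist (gamma t) (gamma v)
  <= fine (curve_length u v gamma).
Proof.
move=> uv /andP[ut tv] fin.
suff le : ((mdist (gamma u) (gamma t) + mdist (gamma t) (gamma v))%:E
           <= curve_length u v gamma)%E.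
  rewrite -lee_fin fineK// fin_numElt fin andbT.
  by apply: lt_le_trans le; rewrite ltNyr.
apply: ereal_sup_ubound.
have puv := itv_partition1 uv.
have [<-|ut'] := eqVneq u t.
  by exists [:: v] => //=; rewrite big_nat1/= mdistxx add0r.
have [->|tv'] := eqVneq t v.
  by exists [:: v] => //=; rewrite big_nat1/= mdistxx addr0.
exists [:: t; v]; last by rewrite big_nat_recl//= big_nat1.
by split => //=; rewrite !lt_neqAle ut' ut tv' tv.
Qed.

End curves.

(** * Integrating the upper derivative along a curve *)

Section integration.
Context {R : realType} {X Y : metricType R}.
Implicit Types (f : X -> Y) (v : X -> R).

Lemma Dstar_lt_along f (gamma : R -> X) (a b t c : R) :
  {within `[a, b], continuous gamma} -> a <= t <= b ->
  (Dstar f (gamma t) < c%:E)%E ->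
  exists2 e, 0 < e & forall u, a <= u <= b -> `|u - t| < e ->
    mdist (f (gamma t)) (f (gamma u)) <= c * mdist (gamma t) (gamma u).
Proof.
move=> /subspace_continuousP cont tab /Dstar_lt_near.
move=> /(cont t); rewrite /= in_itv/= => /(_ tab).
move=> /nbhs_ballP[e e0 eP]; exists e => // u uab ut.
by apply: eP; rewrite /= ?in_itv//= /ball/= distrC.
Qed.

(** The Riemann sum of the tagged partition given by Cousin's lemma is compared
    both with the increment of [f] and with [I].  Adjacent points are compared
    through the tag, since [D* f] controls only increments issued from it. *)
Lemma mdist_le_curve_integral_eps f v (gamma : R -> X) (a b I C eps : R) :
  (forall z, 0 < v z) -> rectifiable_curve a b gamma ->
  is_curve_integral v a b gamma I -> Dstar_bound v f C -> 0 < eps ->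
  mdist (f (gamma a)) (f (gamma b)) <= (C + eps) * (I + eps).
Proof.
move=> v0 [ab cont fin] intI fC eps0.
have C0 : 0 <= C by exact: Dstar_bound_ge0 (v0 (gamma a)) fC.
have [delta delta0 riemann] := intI _ eps0.
pose L u u' := fine (curve_length u u' gamma).
have [||s [xi [pab tags fine_s]]] := @cousin R a b (fun u t u' => u' - u < delta /\
  mdist (f (gamma u)) (f (gamma u')) <= (C + eps) * (v (gamma t) * L u u')).
- by [].
- move=> t tab.
  have [|e e0 eP] := Dstar_lt_along (f := f) (c := (C + eps) * v (gamma t)) cont tab.
    by apply: le_lt_trans (fC _) _; rewrite lte_fin ltr_pM2r// ltrDl.
  exists (Num.min e (delta / 2)); first by rewrite lt_min e0 divr_gt0.
  move=> u u' au /andP[ut tu'] u'b uu' teu u'te.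
  have [et_u dt_u] : t - u < e /\ t - u < delta / 2.
    by apply/andP; rewrite -lt_min ltrBlDr addrC -ltrBlDr.
  have [et_u' dt_u'] : u' - t < e /\ u' - t < delta / 2.
    by apply/andP; rewrite -lt_min ltrBlDr addrC.
  split; first by rewrite (splitr delta) -(subrKA t) ltrD.
  rewrite mulrA; set c := (C + eps) * _ in eP *.
  have c0 : 0 <= c by rewrite mulr_ge0 ?addr_ge0// ltW.
  apply: le_trans (metric_triangle _ (f (gamma t)) _) _.
  have fu : mdist (f (gamma u)) (f (gamma t)) <= c * mdist (gamma u) (gamma t).
    rewrite metric_sym (metric_sym (gamma u)); apply: eP.
      by rewrite au (le_trans ut)//; case/andP: tab.
    by rewrite distrC ger0_norm// subr_ge0.
  have fu' : mdist (f (gamma t)) (f (gamma u')) <= c * mdist (gamma t) (gamma u').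
    apply: eP; first by rewrite u'b andbT (le_trans _ tu')//; case/andP: tab.
    by rewrite ger0_norm// subr_ge0.
  apply: le_trans (lerD fu fu') _; rewrite -mulrDr ler_wpM2l//.
  apply: mdist_le_curve_length => //; first by rewrite ut.
  exact: le_lt_trans (curve_length_sub _ au u'b) fin.
apply: le_trans (polygon_inequality (f \o gamma) pab) _.
pose Sigma := \sum_(0 <= i < size s) v (gamma (xi i)) *
  L (nth b (a :: s) i) (nth b (a :: s) i.+1).
apply: (@le_trans _ _ ((C + eps) * Sigma)).
  rewrite /Sigma mulr_sumr; apply: ler_sum_nat => i /andP[_ /fine_s[_]] //.
rewrite ler_wpM2l ?addr_ge0 ?(ltW eps0)// -lerBlDl.
apply: le_trans (ler_norm _) _; rewrite distrC ltW// riemann// => i ilt.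
have [ltd _] := fine_s i ilt; rewrite ger0_norm// subr_ge0.
by have /andP[] := tags i ilt; exact: le_trans.
Qed.

Lemma mdist_le_curve_integral f v (gamma : R -> X) (a b I C : R) :
  (forall z, 0 < v z) -> rectifiable_curve a b gamma ->
  is_curve_integral v a b gamma I -> Dstar_bound v f C ->
  mdist (f (gamma a)) (f (gamma b)) <= C * I.
Proof.
move=> v0 rect intI fC; apply/ler_addgt0Pr => e e0.
pose k := `|C| + `|I| + 1.
have k0 : 0 < k by rewrite ltr_wpDl// addr_ge0.
pose eps := Num.min 1 (e / k).
have eps0 : 0 < eps by rewrite lt_min ltr01 divr_gt0.
apply: le_trans (mdist_le_curve_integral_eps v0 rect intI fC eps0) _.
have -> : (C + eps) * (I + eps) = C * I + eps * (C + I + eps).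
  by rewrite !mulrDl !mulrDr (mulrC C eps) !addrA.
rewrite lerD2l; apply: (@le_trans _ _ (eps * k)).
  by rewrite ler_wpM2l ?(ltW eps0)// !lerD ?ler_norm// ge_min lexx.
by rewrite -ler_pdivlMr// ge_min lexx orbT.
Qed.

End integration.

(** * Holder bounds and bounds on the upper derivative *)

Section holder.
Context {R : realType} {X Y : metricType R}.
Variables (alpha K : R) (w : X -> R).
Hypotheses (halpha : 0 < alpha < 1) (hw : weight w).
Let v z := w z `^ (alpha - 1).

(** The factor [2 / alpha] is generous: [2 `^ (1 - alpha)] is what the choice
    [r = w z / 2] produces. *)
Lemma holder_Dstar_bound (f : X -> Y) (C' : R) : 0 <= K -> 0 <= C' ->
  RO K w f -> holder_bound alpha f C' -> Dstar_bound v f (2 * K / alpha * C').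
Proof.
move=> K0 C'0 [_ _ oscf] holf z; have [a0 a1] := andP halpha.
have w0 : 0 < w z by case: hw.
pose r := w z / 2; have r0 : 0 < r by rewrite divr_gt0.
have rw : 0 < r < w z by rewrite r0 ltr_pdivrMr// ltr_pMr// ltr1n.
apply: le_trans (oscf z r rw) _.
apply: (@le_trans _ _ ((K / r)%:E * (C' * r `^ alpha)%:E)%E).
  apply: lee_wpmul2l; first by rewrite lee_fin divr_ge0// ltW.
  apply: ge_ereal_sup => _ [y zy <-]; rewrite lee_fin.
  apply: le_trans (holf z y) _; rewrite ler_wpM2l// ge0_ler_powR ?nnegrE ?mdist_ge0//.
  - exact: ltW.
  - exact: ltW.
  - by move: zy; rewrite ballEmdist => /ltW.
rewrite -EFinM lee_fin.
have powr : r `^ alpha = r * (v z * 2^-1 `^ (alpha - 1)).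
  rewrite /v -powRM ?(ltW w0)//.
  by rewrite mulr_powRB1 ?(ltW r0).
have half_le : (2^-1 : R) `^ (alpha - 1) <= 2.
  rewrite -powR_inv1// -powRrM mulN1r opprB ler1_powR ?ler1n//.
  by rewrite lerBlDr lerDl ltW.
have -> : K / r * (C' * r `^ alpha) = K * C' * v z * 2^-1 `^ (alpha - 1).
  by rewrite powr; field; rewrite gt_eqF.
have -> : 2 * K / alpha * C' * v z = K * C' * v z * (2 / alpha).
  by field; rewrite gt_eqF.
rewrite ler_wpM2l ?mulr_ge0 ?powR_ge0//; apply: le_trans half_le _.
by rewrite ler_pdivlMr// ler_piMr// ltW.
Qed.

Lemma Dstar_bound_holder (M : R) (f : X -> Y) (C : R) :
  (forall x y : X, exists (a b : R) (gamma : R -> X) (I : R),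
      [/\ rectifiable_curve a b gamma, gamma a = x, gamma b = y,
          is_curve_integral v a b gamma I & I <= M * mdist x y `^ alpha]) ->
  Dstar_bound v f C -> holder_bound alpha f (M * C).
Proof.
move=> hcurves fC x y.
have v0 z : 0 < v z by apply: powR_gt0; case: hw.
have [a [b [gamma [I [rect <- <- intI leI]]]]] := hcurves x y.
apply: le_trans (mdist_le_curve_integral v0 rect intI fC) _.
rewrite (mulrC M) -mulrA ler_wpM2l//.
exact: Dstar_bound_ge0 (v0 x) fC.
Qed.

End holder.

Theorem corollary3p4 (R : realType) (X Y : metricType R) (alpha K M : R)
    (w : X -> R)
    (halpha : 0 < alpha < 1) (hK : 0 < K) (hM : 0 < M) (hw : weight w)
    (hcurves : forall x y : X, exists (a b : R) (gamma : R -> X) (I : R),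
      [/\ rectifiable_curve a b gamma, gamma a = x, gamma b = y,
          is_curve_integral (fun z => w z `^ (alpha - 1)) a b gamma I &
          I <= M * mdist x y `^ alpha]) :
  let v := fun z : X => w z `^ (alpha - 1) in
  [/\ (@RO R X Y K w `&` @Lambda R X Y alpha
       = @RO R X Y K w `&` @Bclass R X Y v),
      forall f : X -> Y, RO K w f ->
        ((exists C, Dstar_bound v f C) <-> (exists C', holder_bound alpha f C')),
      forall (f : X -> Y) (C : R), RO K w f -> Dstar_bound v f C ->
        exists2 C', C' <= M * C & holder_bound alpha f C' &
      forall (f : X -> Y) (C' : R), RO K w f -> 0 <= C' ->
        holder_bound alpha f C' ->
        exists2 C, C <= 2 * K / alpha * C' & Dstar_bound v f C].
Proof.
move=> v.
have toHolder (f : X -> Y) C : Dstar_bound v f C -> holder_bound alpha f (M * C).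
  exact: Dstar_bound_holder.
have fromHolder (f : X -> Y) C : RO K w f -> 0 <= C -> holder_bound alpha f C ->
    Dstar_bound v f (2 * K / alpha * C).
  by move=> ROf C0; apply: holder_Dstar_bound => //; exact: ltW.
have equiv (f : X -> Y) : RO K w f ->
    ((exists C, Dstar_bound v f C) <-> exists C', holder_bound alpha f C').
  move=> ROf; split=> [[C /toHolder]|[C' fC']]; first by exists (M * C).
  (* [C'] itself may be negative, when [X] has at most one point. *)
  exists (2 * K / alpha * `|C'|); apply: fromHolder => // x y.
  by apply: le_trans (fC' x y) _; rewrite ler_wpM2r ?powR_ge0 ?ler_norm.
split.
- apply/seteqP; split=> f [ROf].
    by move=> /(equiv f ROf) bf; split=> //; split=> //; case: ROf.
  by case=> _ bf; split=> //; exact/(equiv f ROf).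
- exact: equiv.
- by move=> f C _ fC; exists (M * C) => //; exact: toHolder.
- by move=> f C' ROf C'0 fC'; exists (2 * K / alpha * C') => //; exact: fromHolder.
Qed.
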